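(* Every finite simple graph $G$ with at least one vertex contains a nonempty $2$-cheap set.
   Context: For a vertex $v$, $\zeta(v)=\max_H\delta(H)$, the maximum over all subgraphs $H$ of $G$ containing $v$, where $\delta(H)$ is the minimum degree. $N[X]=X\cup\bigcup_{v\in X}N(v)$. For an integer $k\geq 0$, a $k$-cheap set of $G$ is either a subset of the isolated vertices of $G$, or a set $S$ of non-isolated vertices of $G$ such that (i) $\sum_{v\in N[S]}\frac{1}{\zeta(v)+\frac{1}{k+1}}\leq |S|$ and (ii) $\Delta(G[S])\leq k$. *)

(* Defs.v *)
From mathcomp Require Import all_boot all_order all_algebra.

Set Implicit Arguments.
Unset Strict Implicit.
Unset Printing Implicit Defensive.

Import Order.TTheory GRing.Theory Num.Theory.

(* A finite simple graph is a symmetric, irreflexive relation e on a finite   *)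
(* type T of vertices; both properties are hypotheses wherever they matter.   *)

Definition nbh (T : finType) (e : rel T) (v : T) : {set T} :=
  [set u | e v u].

Definition closed_nbh (T : finType) (e : rel T) (X : {set T}) : {set T} :=
  X :|: \bigcup_(v in X) nbh e v.

Definition isolated (T : finType) (e : rel T) (v : T) : bool :=
  nbh e v == set0.

(* A pair H = (W, F) of vertices and unordered edges {x, y}; subgraphs need   *)
(* not be induced. *)
Definition subgraph (T : finType) (e : rel T)
    (H : {set T} * {set {set T}}) : bool :=
  [forall f in H.2, exists x in H.1, exists y in H.1,
     e x y && (f == [set x; y])].

Definition sub_degree (T : finType) (H : {set T} * {set {set T}}) (v : T)
    : nat :=
  #|[set f in H.2 | v \in f]|.

(* The default value #|T| exceeds every degree in a subgraph of a simple      *)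
(* graph, so it only matters when H has no vertex. *)
Definition min_degree (T : finType) (H : {set T} * {set {set T}}) : nat :=
  \big[minn/#|T|]_(v in H.1) sub_degree H v.

Definition zeta (T : finType) (e : rel T) (v : T) : nat :=
  \max_(H : {set T} * {set {set T}} | subgraph e H && (v \in H.1))
     min_degree H.

(* Delta(G[S]) *)
Definition max_degree_induced (T : finType) (e : rel T) (S : {set T}) : nat :=
  \max_(v in S) #|nbh e v :&: S|.

Definition cheap (T : finType) (e : rel T) (k : nat) (S : {set T}) : Prop :=
  (forall v, v \in S -> isolated e v) \/
  [/\ forall v, v \in S -> ~~ isolated e v,
      (\sum_(v in closed_nbh e S) ((zeta e v)%:R + (k.+1)%:R^-1)^-1
         <= #|S|%:R :> rat)%R
    & max_degree_induced e S <= k].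

(* Main.v *)
Require Import Defs.
From mathcomp Require Import all_boot all_order all_algebra.
From mathcomp Require Import zify ring lra.

(* Suppose no set is cheap and let d be the minimum degree, d > 0. A vertex   *)
(* of a set W with minimum degree d inside W has zeta at least d, and we peel *)
(* the graph down to sets W with larger and larger such d. In W, let low be   *)
(* the vertices of degree exactly d in W and stem the vertices that have      *)
(* degree at most d once low is removed. Any overlap of neighbourhoods saves  *)
(* enough for a set of at most four vertices to be cheap: hence low is        *)
(* independent, each stem vertex hangs on exactly one low vertex (a twig),    *)
(* twigs are far apart, and removing low and stem leaves minimum degree at    *)
(* least d + 1. Then the outer vertices have zeta > d, so a twig would be     *)
(* cheap: stem is empty, and removing low alone raises d by one. The peeled   *)
(* vertices keep disjoint neighbourhoods inside W, and as soon as d >= 4 each *)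
(* of them is cheap on its own.                                               *)

Set Implicit Arguments.
Unset Strict Implicit.
Unset Printing Implicit Defensive.

Import Order.TTheory GRing.Theory Num.Theory.

(* Hiding the boolean hypotheses keeps [lia] from splitting on each of them. *)
Ltac arith :=
  intros; repeat match goal with
  | H : is_true ?b |- _ => lazymatch b with leq _ _ => fail | _ => clear H end
  | H : _ = false |- _ => clear H
  end; lia.

(** The proof is an accounting argument. A vertex of [S] pays 1, a vertex of [N[S]] costs [wt v],
    and [costly] says that no nonempty set of maximum degree at most 2 pays for itself. In a core
    [W] of minimum degree [d] every vertex costs at most 3/(3d+1), so a small set [s] has more than
    (d + 1/3)|s| vertices in its closed neighbourhood inside [W] ([core_nbh_large]). Low vertices
    reach only d + 1 vertices each, so a few vertices around them whose neighbourhoods overlap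
    violate this bound. Vertices peeled earlier do no harm: they join the set, each with a surplus
    of at least 1/4 ([costly_core]).

    Hence peeling [low] off a [layered] set gives a [layered] set for d + 1 ([layered_upper]). A
    peeled vertex keeps its degree while its neighbours get cheaper, and from d = 4 on it would pay
    for itself alone ([peeled_cost_le1]). So a layered set omits no vertex ([layered_setT]), yet
    peeling the whole graph at its minimum degree removes one. *)

Section CheapSets.

Variables (T : finType) (e : rel T).
Hypotheses (e_sym : symmetric e) (e_irr : irreflexive e).

Notation N := (nbh e).

(** * Lower bounds on [zeta], and sums of weights *)

Definition deg_in (W : {set T}) (v : T) : nat := #|N v :&: W|.

Lemma deg_inT v : deg_in setT v = #|N v|.
Proof. by rewrite /deg_in setIT. Qed.

(** The subgraph induced on [W] is a witness: distinct neighbours of [u] in [W] give distinct edges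
    at [u]. *)
Lemma le_zeta (W : {set T}) d :
  (forall v, v \in W -> d <= deg_in W v) ->
  forall v, v \in W -> d <= zeta e v.
Proof.
move=> minW v vW.
pose F := [set [set x; y] | x in W, y in W & e x y].
have subF : subgraph e (W, F).
  apply/forall_inP => f /imset2P [x y xW]; rewrite inE => /andP [yW exy] ->.
  by apply/exists_inP; exists x => //; apply/exists_inP; exists y; rewrite ?exy ?eqxx.
apply: (@leq_trans (min_degree (W, F))); last first.
  by apply: (bigop.bigmax_sup (W, F)) => //; rewrite subF vW.
rewrite /min_degree /=; elim/big_ind: _ => [|a b da db|u uW].
(* The default value of the minimum is harmless, as [d] is at most a degree. *)
- by apply: leq_trans (minW v vW) (max_card _).
- by rewrite leq_min da db.
apply: leq_trans (minW u uW) _; rewrite /deg_in /sub_degree /=.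
rewrite -(card_in_imset (f := fun y => [set u; y])) => [|y z]; last first.
  rewrite !inE => /andP [euy _] _ /setP /(_ y); rewrite !inE eqxx orbT.
  by case: eqP euy => [->|_ _ /esym /eqP //]; rewrite e_irr.
apply/subset_leq_card/subsetP => f /imsetP [y]; rewrite !inE => /andP [euy yW] ->.
by rewrite set21 andbT; apply: imset2_f; rewrite ?inE ?yW ?euy.
Qed.

(** The summand in the definition of a 2-cheap set; 3 is k + 1. *)
Definition wt (v : T) : rat := ((zeta e v)%:R + 3%:R^-1)^-1%R.
Definition wt_of (d : nat) : rat := (d%:R + 3%:R^-1)^-1%R.

Lemma wt_of_gt0 d : (0 < wt_of d)%R.
Proof. by rewrite invr_gt0 ltr_wpDl. Qed.

Lemma wt_ge0 v : (0 <= wt v)%R.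
Proof. exact: ltW (wt_of_gt0 _). Qed.

Lemma wt_le d v : d <= zeta e v -> (wt v <= wt_of d)%R.
Proof.
move=> dv; rewrite /wt /wt_of lef_pV2 ?posrE ?ltr_wpDl ?ler0n //.
by rewrite lerD2r ler_nat.
Qed.

Lemma wt_of_le c d : c <= d -> (wt_of d <= wt_of c)%R.
Proof.
move=> cd; rewrite /wt_of lef_pV2 ?posrE ?ltr_wpDl ?ler0n //.
by rewrite lerD2r ler_nat.
Qed.

Lemma wt_ofE d : wt_of d = (3 / (3 * d + 1)%:R :> rat)%R.
Proof.
rewrite /wt_of natrD natrM; have : (0 <= d%:R :> rat)%R by [].
by move=> d0; field; lra.
Qed.

Lemma sum_setU_le (A B : {set T}) (F : T -> rat) :
  (forall v, 0 <= F v)%R ->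
  (\sum_(v in A :|: B) F v <= \sum_(v in A) F v + \sum_(v in B) F v)%R.
Proof.
move=> F0; rewrite big_mkcond [X in (_ <= X + _)%R]big_mkcond.
rewrite [X in (_ <= _ + X)%R]big_mkcond -big_split /=.
apply: ler_sum => v _; have := F0 v; rewrite inE.
by case: (v \in A); case: (v \in B) => /=; lra.
Qed.

Lemma sum_bigcup_le (Z : {set T}) (A : T -> {set T}) (F : T -> rat) :
  (forall v, 0 <= F v)%R ->
  (\sum_(v in \bigcup_(z in Z) A z) F v <= \sum_(z in Z) \sum_(v in A z) F v)%R.
Proof.
move=> F0; elim/big_ind2: _ => [|x1 x2 y1 y2 h1 h2|//].
  by rewrite big_set0.
by apply: le_trans (sum_setU_le _ _ F0) _; apply: lerD.
Qed.

Lemma sum_subset_le (A B : {set T}) (F : T -> rat) :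
  (forall v, 0 <= F v)%R -> A \subset B ->
  (\sum_(v in A) F v <= \sum_(v in B) F v)%R.
Proof.
move=> F0 /subsetP AB; rewrite big_mkcond [X in (_ <= X)%R]big_mkcond.
apply: ler_sum => v _; have := AB v; case: (v \in A) => [->//|_].
by case: ifP.
Qed.

Lemma sum_const_le (A : {set T}) (F : T -> rat) c :
  (forall v, v \in A -> F v <= c)%R -> (\sum_(v in A) F v <= #|A|%:R * c)%R.
Proof.
by move=> Fc; apply: le_trans (ler_sum _ Fc) _; rewrite sumr_const mulr_natl.
Qed.

(** * The assumption to refute, and the peeling invariant *)

Definition costly : Prop := forall S : {set T},
  S != set0 -> max_degree_induced e S <= 2 ->
  (#|S|%:R < \sum_(v in closed_nbh e S) wt v)%R.

(** The state after some rounds of peeling. A vertex is peeled when its neighbours all lie in the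
    core and its degree is the minimum there, whence [zeta_peeled]. By [uniq_peeled], a core vertex
    in a chosen set may also have its peeled neighbour in the set and still one more neighbour. *)
Record layered (W : {set T}) (d : nat) : Prop := Layered {
  min_deg_core : forall v, v \in W -> d <= deg_in W v;
  nbh_peeled : forall y, y \notin W -> N y \subset W;
  deg_peeled : forall y, y \notin W -> #|N y| < d;
  zeta_peeled : forall y, y \notin W -> #|N y| <= zeta e y;
  uniq_peeled : forall v, v \in W -> #|N v :\: W| <= 1 }.

Section Step.

Variables (W : {set T}) (d : nat).
Hypotheses (no_isolated : forall v, 0 < #|N v|) (all_costly : costly).
Hypotheses (d_gt0 : 0 < d) (LW : layered W d).
Hypothesis deg_peeled2 : forall y, y \notin W -> #|N y| <= 2.

Notation deg := (deg_in W).

(** * Closed neighbourhoods inside the core are large *)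

Definition core_nbh (s : seq T) : {set T} :=
  [set v in W | has (fun u => (u == v) || e u v) s].

Definition touching (s : seq T) : {set T} :=
  [set y | (y \notin W) && (N y :&: core_nbh s != set0)].

Lemma core_zeta v : v \in W -> d <= zeta e v.
Proof. exact: le_zeta (min_deg_core LW) v. Qed.

(* A peeled vertex added to a set pays 1 and costs at most 3/4, since         *)
(* one of its at most two neighbours is already counted in [C].               *)
Lemma touching_cost (C : {set T}) z :
  z \notin W -> N z :&: C != set0 ->
  (wt z + \sum_(v in N z :\: C) wt v <= 3%:R / 4%:R)%R.
Proof.
move=> zW; rewrite -card_gt0 => zC.
have k_gt0 := no_isolated z; have k2 := deg_peeled2 zW; have kd := deg_peeled LW zW.
have wz := wt_le (zeta_peeled LW zW).
have : (\sum_(v in N z :\: C) wt v <= #|N z :\: C|%:R * wt_of d)%R.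
  apply: sum_const_le => v; rewrite inE => /andP [_ vN].
  by apply/wt_le/core_zeta/(subsetP (nbh_peeled LW zW)).
have : #|N z :\: C| <= #|N z|.-1 by rewrite cardsD; lia.
case: (posnP #|N z :\: C|) => [->|c_gt0 c1].
  have : (wt_of #|N z| <= wt_of 1)%R by apply: wt_of_le.
  by rewrite [wt_of 1](_ : _ = 3 / 4)%R ?mul0r => [w1 _ sN|]; [lra|exact: wt_ofE].
(* Here d > 2, so the cost is at most 3/7 + 3/10 < 3/4. *)
have [k c] : #|N z| = 2 /\ #|N z :\: C| = 1 by lia.
have : (wt_of d <= wt_of 3)%R by apply: wt_of_le; lia.
move: wz; rewrite c k [wt_of 2](_ : _ = 3 / 7)%R; last exact: wt_ofE.
by rewrite [wt_of 3](_ : _ = 3 / 10)%R => [w2 w3 sN|]; [lra|exact: wt_ofE].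
Qed.

(** Apply [costly] to [s] together with [touching s]. This absorbs the peeled neighbours of [s], and
    each added vertex leaves 1 - 3/4 over. *)
Lemma costly_core (s : seq T) :
  s != [::] -> uniq s -> {subset s <= W} ->
  (forall v, v \in s -> count (e v) s + #|N v :\: W| <= 2) ->
  ((size s)%:R + #|touching s|%:R / 4%:R < \sum_(v in core_nbh s) wt v)%R.
Proof.
move=> s0 us sW sdeg; set Z := touching s; set C := core_nbh s.
have sC v : v \in s -> v \in C.
  by move=> vs; rewrite inE sW //; apply/hasP; exists v; rewrite ?eqxx.
pose S := [set x in s] :|: Z.
have nbhS v : v \in s -> N v :\: W \subset Z.
  move=> vs; apply/subsetP => y; rewrite !inE => /andP [-> evy] /=.
  by apply/set0Pn; exists v; rewrite inE sC // inE e_sym evy.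
have cardS : #|S| = size s + #|Z|.
  rewrite cardsU -(card_uniqP us) cardsE.
  suff -> : [set x in s] :&: Z = set0 by rewrite cards0 subn0.
  apply/setP => x; rewrite !inE; apply/negbTE/negP => /and3P [xs xW _].
  by rewrite (sW _ xs) in xW.
have S0 : S != set0.
  by rewrite -card_gt0 cardS; case: (s) s0.
have degS : max_degree_induced e S <= 2.
  apply/bigop.bigmax_leqP => v; rewrite inE => /orP [|vZ]; last first.
    apply: leq_trans (deg_peeled2 (y := v) _); last by case/setIdP: vZ.
    exact/subset_leq_card/subsetIl.
  rewrite inE => vs; apply: leq_trans (sdeg v vs).
  apply: (@leq_trans #|[set x in filter (e v) s] :|: N v :\: W|).
    apply/subset_leq_card/subsetP => x; rewrite !inE mem_filter.
    by case/andP => -> /orP [->//|/andP [-> _]]; rewrite orbT.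
  rewrite cardsU; apply: leq_trans (leq_subr _ _) _.
  by rewrite leq_add2r cardsE -size_filter card_size.
have := all_costly S0 degS; rewrite cardS.
set lhs := (_%:R)%R => lt_sum.
have le_sum : (\sum_(v in closed_nbh e S) wt v <=
    \sum_(v in C) wt v + #|Z|%:R * (3%:R / 4%:R))%R.
  apply: (@le_trans _ _ (\sum_(v in C :|: (Z :|: \bigcup_(z in Z) (N z :\: C))) wt v)%R).
    apply: sum_subset_le wt_ge0 _; apply/subsetP => v.
    have cZ x : x \in Z -> v \in N x -> v \in C :|: (Z :|: \bigcup_(z in Z) (N z :\: C)).
      move=> xZ vx; rewrite inE; case: (boolP (v \in C)) => //= vC.
      by rewrite inE; apply/orP; right; apply/bigcupP; exists x; rewrite // inE vC.
    rewrite inE => /orP [|/bigcupP [x]].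
      case/setUP => [|vZ]; first by rewrite inE => vs; rewrite in_setU sC.
      by rewrite !in_setU vZ orbT.
    case/setUP => [|/cZ] //; rewrite inE => xs vx.
    case: (boolP (v \in W)) => vW.
      rewrite in_setU; apply/orP; left; rewrite inE vW; apply/hasP; exists x => //.
      by move: vx; rewrite inE => ->; rewrite orbT.
    by rewrite !in_setU (subsetP (nbhS _ xs)) ?orbT // inE vW.
  apply: le_trans (sum_setU_le _ _ wt_ge0) _; rewrite lerD2l.
  apply: le_trans (sum_setU_le _ _ wt_ge0) _.
  apply: le_trans (lerD (lexx _) (sum_bigcup_le _ _ wt_ge0)) _.
  rewrite -big_split /=; apply: sum_const_le => z; rewrite inE => /andP [].
  exact: touching_cost.
by move: lt_sum le_sum; rewrite /lhs natrD; lra.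
Qed.

Lemma card_core_nbh_gt (s : seq T) :
  s != [::] -> uniq s -> {subset s <= W} ->
  (forall v, v \in s -> count (e v) s + #|N v :\: W| <= 2) ->
  (3 * d + 1) * (4 * size s + #|touching s|) < 12 * #|core_nbh s|.
Proof.
move=> s0 us sW sdeg; have := costly_core s0 us sW sdeg => lt_sum.
have : (\sum_(v in core_nbh s) wt v <= #|core_nbh s|%:R * wt_of d)%R.
  by apply: sum_const_le => v /setIdP [vW _]; apply/wt_le/core_zeta.
move/(lt_le_trans lt_sum); rewrite wt_ofE mulrA ltr_pdivlMr ?ltr0n ?addn1 //.
by rewrite -(ltr_nat rat) !(natrM, natrD); lra.
Qed.

(** A sharper count, with denominators cleared: only [s] is charged at [wt_of d], the at most [n]
    other vertices at [wt_of d.+1]. *)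
Lemma core_nbh_budget (s : seq T) n :
  s != [::] -> uniq s -> {subset s <= W} ->
  (forall v, v \in s -> count (e v) s + #|N v :\: W| <= 2) ->
  (forall v, v \in core_nbh s -> v \notin s -> d < zeta e v) ->
  #|core_nbh s| <= size s + n ->
  (4 * size s + #|touching s|) * (3 * d + 1) * (3 * d + 4) <
    12 * (size s * (3 * d + 4) + n * (3 * d + 1)).
Proof.
move=> s0 us sW sdeg zC leC; have := costly_core s0 us sW sdeg => lt_sum.
have cS : #|[set x in s]| = size s by rewrite cardsE; apply/card_uniqP.
have le_sum : (\sum_(v in core_nbh s) wt v <=
    (size s)%:R * wt_of d + n%:R * wt_of d.+1)%R.
  rewrite (big_setID [set x in s]) /=; apply: lerD.
    apply: (@le_trans _ _ (\sum_(v in [set x in s]) wt v)%R).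
      by apply: sum_subset_le wt_ge0 _; apply: subsetIr.
    rewrite -cS; apply: sum_const_le => v; rewrite inE => vs.
    exact/wt_le/core_zeta/sW.
  apply: (@le_trans _ _ (#|core_nbh s :\: [set x in s]|%:R * wt_of d.+1)%R).
    apply: sum_const_le => v; rewrite !inE => /and3P [vs vW sv].
    by apply/wt_le/zC => //; rewrite inE vW.
  rewrite ler_pM2r ?wt_of_gt0 // ler_nat cardsD.
  suff -> : core_nbh s :&: [set x in s] = [set x in s] by rewrite cS; lia.
  apply/setIidPr/subsetP => v; rewrite !inE => vs; rewrite sW //.
  by apply/hasP; exists v; rewrite ?eqxx.
have := lt_le_trans lt_sum le_sum; rewrite !wt_ofE.
rewrite -(ltr_nat rat) !(natrM, natrD).
have : (0 <= d%:R :> rat)%R by [].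
have -> : (d.+1%:R = d%:R + 1 :> rat)%R by rewrite -natr1.
move: (d%:R)%R (n%:R)%R ((size s)%:R)%R (#|touching s|%:R)%R => D n' S' Z' D0.
set X := (3 * D + 1)%R; have -> : (3 * (D + 1) + 1 = X + 3 :> rat)%R by rewrite /X; ring.
have -> : (3 * D + 4 = X + 3 :> rat)%R by rewrite /X; ring.
have X0 : (0 < X)%R by rewrite /X; lra.
have X3 : (0 < X + 3)%R by lra.
rewrite -(ltr_pM2r (mulr_gt0 X0 X3)).
have -> : ((S' * (3 / X) + n' * (3 / (X + 3))) * (X * (X + 3)) =
  3 * (S' * (X + 3) + n' * X))%R by field; lra.
lra.
Qed.

Lemma mem_core_nbh_self v s : v \in W -> v \in s -> v \in core_nbh s.
Proof. by move=> vW vs; rewrite inE vW; apply/hasP; exists v; rewrite ?eqxx. Qed.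

Lemma mem_core_nbh u v s : v \in W -> u \in s -> e u v -> v \in core_nbh s.
Proof. by move=> vW us uv; rewrite inE vW; apply/hasP; exists u; rewrite ?uv ?orbT. Qed.

Lemma card_core_nbh1 v : v \in W -> #|core_nbh [:: v]| = (deg v).+1.
Proof.
move=> vW; rewrite (cardsD1 v) mem_core_nbh_self ?inE // add1n; congr _.+1.
apply: eq_card => x; rewrite !inE /= orbF andbC.
by rewrite eq_sym; case: eqP => [<-|_]; rewrite ?e_irr ?andbF //= andbT andbC.
Qed.

(** Inclusion-exclusion, where [A] collects vertices counted twice. Below, a common vertex saves one
    and an edge saves two. *)
Lemma card_core_nbh_cons (A : {set T}) v s : v \in W ->
  A \subset core_nbh [:: v] -> A \subset core_nbh s ->
  #|core_nbh (v :: s)| + #|A| <= #|core_nbh s| + (deg v).+1.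
Proof.
move=> vW Av As; have -> : core_nbh (v :: s) = core_nbh [:: v] :|: core_nbh s.
  by apply/setP => x; rewrite !inE /= orbF andb_orr.
have AI : #|A| <= #|core_nbh [:: v] :&: core_nbh s|.
  by apply/subset_leq_card; rewrite subsetI Av.
have := subset_leq_card (subsetIl (core_nbh [:: v]) (core_nbh s)).
by rewrite -(card_core_nbh1 vW) addnC cardsU; lia.
Qed.

Lemma card_core_nbh_share x v s : v \in W ->
  x \in core_nbh [:: v] -> x \in core_nbh s ->
  #|core_nbh (v :: s)| <= #|core_nbh s| + deg v.
Proof.
move=> vW xv xs; have := @card_core_nbh_cons [set x] v s vW.
by rewrite !sub1set cards1 => /(_ xv xs); lia.
Qed.

Lemma card_core_nbh_adj u v s : u \in W -> v \in W -> u \in s -> e u v ->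
  #|core_nbh (v :: s)| < #|core_nbh s| + deg v.
Proof.
move=> uW vW us uv; have := @card_core_nbh_cons [set u; v] v s vW.
rewrite !subUset !sub1set cards2 (mem_core_nbh vW us uv).
rewrite (mem_core_nbh_self uW us) (mem_core_nbh_self vW (mem_head _ _)).
rewrite (mem_core_nbh uW (mem_head v _)) ?[e v u]e_sym //.
have -> : u != v by apply: contraTneq uv => ->; rewrite e_irr.
by move=> /(_ isT isT); lia.
Qed.

(** The condition under which adding [touching s] keeps the maximum degree at most 2. *)
Definition extendable (s : seq T) : bool :=
  uniq s && all (fun v => (v \in W) && (count (e v) s + #|N v :\: W| <= 2)) s.

Lemma extendableP s : extendable s ->
  [/\ uniq s, {subset s <= W} &
      forall v, v \in s -> count (e v) s + #|N v :\: W| <= 2].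
Proof.
by case/andP => us /allP sP; split=> // v /sP /andP [].
Qed.

(** By integrality, sets of 2, 3, 4 vertices reach at least 2d + 1, 3d + 2, 4d + 2 vertices. The
    overlap arguments below contradict these thresholds. *)
Lemma core_nbh_large s : extendable s -> s != [::] ->
  (3 * d + 1) * size s < 3 * #|core_nbh s|.
Proof.
move=> /extendableP [us sW sdeg] s0; have := card_core_nbh_gt s0 us sW sdeg.
rewrite mulnDr mulnCA => /(leq_ltn_trans (leq_addr _ _)).
by rewrite -[12]/(4 * 3) -mulnA ltn_pmul2l.
Qed.

Lemma peeled_le1 v : v \in W -> 1 + #|N v :\: W| <= 2.
Proof. exact: uniq_peeled LW v. Qed.

Lemma peeled_le2 v : v \in W -> #|N v :\: W| <= 2.
Proof. by move/(uniq_peeled LW)/leqW. Qed.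

Lemma extendable_pair (u v : T) : u != v -> u \in W -> v \in W -> extendable [:: u; v].
Proof.
move=> uv uW vW; have [pu pv] := (uniq_peeled LW uW, uniq_peeled LW vW).
by rewrite /extendable /= inE uv uW vW !e_irr; lia.
Qed.

Lemma touching_pair0 (u v : T) : u != v -> u \in W -> v \in W ->
  #|core_nbh [:: u; v]| <= 2 * d + 1 -> touching [:: u; v] = set0.
Proof.
move=> uv uW vW leC; apply/eqP; rewrite -cards_eq0 -leqn0 leqNgt; apply/negP => t0.
have [us sW sdeg] := extendableP (extendable_pair uv uW vW).
(* One touching vertex would give 9(3d + 1) < 12(2d + 1), that is d < 1. *)
suff : (3 * d + 1) * (4 * 2 + #|touching [:: u; v]|) < 12 * #|core_nbh [:: u; v]| by nia.
exact: card_core_nbh_gt.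
Qed.

Lemma touching0 s v : touching s = set0 -> v \in core_nbh s -> N v :\: W = set0.
Proof.
move=> s0 vs; apply/setP => y; rewrite in_set0 !inE; apply/negP => /andP [yW vy].
suff : y \in touching s by rewrite s0 inE.
by rewrite inE yW; apply/set0Pn; exists v; rewrite inE vs inE e_sym vy.
Qed.

(** * Low vertices and the stem *)

Definition low : {set T} := [set v in W | deg v == d].
Definition upper : {set T} := W :\: low.
Definition stem : {set T} := [set u in upper | deg_in upper u <= d].

Lemma lowP b : b \in low -> b \in W /\ deg b = d.
Proof. by rewrite inE => /andP [-> /eqP ->]. Qed.

Lemma upperP u : u \in upper -> u \in W /\ d < deg u.
Proof.
rewrite !inE => /andP [+ uW]; rewrite uW /= => degu; split=> //.
by rewrite ltn_neqAle eq_sym degu (min_deg_core LW).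
Qed.

Lemma stem_upper u : u \in stem -> u \in upper.
Proof. by case/setIdP. Qed.

Lemma low_upper_neq b u : b \in low -> u \in upper -> b != u.
Proof. by move=> bl; rewrite inE => /andP [ul _]; apply: contraNneq ul => <-. Qed.

Lemma deg_inD (A B : {set T}) v : B \subset A ->
  deg_in A v = deg_in (A :\: B) v + deg_in B v.
Proof.
move=> BA; rewrite /deg_in -(cardsID B (N v :&: A)) addnC; congr (_ + _).
  by rewrite setIDA.
by rewrite -setIA (setIidPr BA).
Qed.

Lemma deg_split v : deg v = deg_in upper v + deg_in low v.
Proof. by apply: deg_inD; apply/subsetP => x /lowP []. Qed.

Lemma low_indep b b' : b \in low -> b' \in low -> e b b' = false.
Proof.
move=> bl b'l; apply/negP => bb'.
have [[bW db] [b'W db']] := (lowP bl, lowP b'l).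
have b'b : e b' b by rewrite e_sym.
have := card_core_nbh_adj (s := [:: b']) b'W bW (mem_head _ _) b'b.
rewrite card_core_nbh1 // db db' => leC.
have neq : b != b' by apply: contraTneq bb' => ->; rewrite e_irr.
by have := core_nbh_large (extendable_pair neq bW b'W) isT; rewrite /=; arith.
Qed.

Lemma mem_core_nbh1 u v : v \in W -> e u v -> v \in core_nbh [:: u].
Proof. by move=> vW; apply: mem_core_nbh (mem_head _ _). Qed.

(** Three low vertices with a common neighbour reach at most 3(d + 1) - 2 vertices, one too few. *)
Lemma low_deg_le2 x : x \in W -> deg_in low x <= 2.
Proof.
move=> xW; rewrite leqNgt; apply/negP => /card_gt2P [b1 [b2 [b3 [[]]]]].
move=> /setIP [+ l1] /setIP [+ l2] /setIP [+ l3] [n12 n23 n31].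
rewrite !inE => x1 x2 x3.
have [[W1 d1] [W2 d2] [W3 d3]] := And3 (lowP l1) (lowP l2) (lowP l3).
have xb b : e x b -> x \in core_nbh [:: b] by rewrite e_sym; apply: mem_core_nbh1.
have ext : extendable [:: b1; b2; b3].
  rewrite /extendable /= !inE !negb_or !low_indep // n12 n23 [b1 == _]eq_sym n31 W1 W2 W3.
  by rewrite /= !add0n !peeled_le2.
have c3 := card_core_nbh1 W3.
have c2 := card_core_nbh_share (s := [:: b3]) W2 (xb _ x2) (xb _ x3).
have x23 : x \in core_nbh [:: b2; b3].
  by rewrite e_sym in x2; apply: mem_core_nbh x2; rewrite ?inE ?eqxx.
have c1 := card_core_nbh_share (s := [:: b2; b3]) W1 (xb _ x1) x23.
by have := core_nbh_large ext isT; rewrite /=; arith.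
Qed.

Lemma stem_deg u : u \in stem -> [/\ u \in W, d < deg u & 0 < deg_in low u].
Proof.
move=> us; have [uW degu] := upperP (stem_upper us); split=> //.
by move: us; rewrite inE => /andP [_]; have := deg_split u; arith.
Qed.

(** The pair [b], [b'] shares [u], so no peeled vertex touches it. Hence [u] has no peeled neighbour
    and may be the middle of the path b, u, b', which reaches at most 3d + 1 vertices. *)
Lemma stem_low_uniq u b b' : u \in stem -> b \in low -> b' \in low ->
  e u b -> e u b' -> b = b'.
Proof.
move=> us bl b'l ub ub'; apply/eqP; apply: contraT => neq.
have [[bW db] [b'W db']] := (lowP bl, lowP b'l).
have [uW _ _] := stem_deg us.
have [bu b'u] : e b u /\ e b' u by rewrite ![e _ u]e_sym.
have t0 : touching [:: b; b'] = set0.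
  apply: touching_pair0 => //.
  have := card_core_nbh_share (s := [:: b']) bW
    (mem_core_nbh1 uW bu) (mem_core_nbh1 uW b'u).
  rewrite card_core_nbh1 // db db'. arith.
have pu : #|N u :\: W| = 0.
  by apply/eqP; rewrite cards_eq0 (touching0 t0) // (mem_core_nbh _ (mem_head _ _)).
have [nbu nb'u] := (low_upper_neq bl (stem_upper us), low_upper_neq b'l (stem_upper us)).
have ext : extendable [:: b; b'; u].
  rewrite /extendable /= !inE !negb_or !e_irr !(low_indep bl b'l, low_indep b'l bl).
  rewrite neq nbu nb'u bW b'W uW.
  rewrite bu b'u ub ub' pu. by rewrite /= !add0n ?addn0 !peeled_le1.
have degu : deg u <= d + 2.
  have := low_deg_le2 uW; have := deg_split u; move: us; rewrite inE => /andP []; arith.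
have c1 := card_core_nbh1 uW.
have c2 := card_core_nbh_adj (s := [:: u]) uW b'W (mem_head _ _) ub'.
have u2 : u \in [:: b'; u] by rewrite !inE eqxx orbT.
have c3 := card_core_nbh_adj (s := [:: b'; u]) uW bW u2 ub.
by have := core_nbh_large ext isT; rewrite /=; arith.
Qed.

(** * Twigs are far apart *)

Definition twig (u b : T) : bool := [&& u \in stem, b \in low & e u b].

Lemma stem_twig u : u \in stem -> exists b, twig u b.
Proof.
move=> us; have [_ _ /card_gt0P [b]] := stem_deg us.
by rewrite 2!inE => /andP [ub bl]; exists b; rewrite /twig us bl.
Qed.

Lemma twigP u b : twig u b ->
  [/\ u \in stem, b \in low, e u b /\ e b u, u \in W /\ b \in W & b != u].
Proof.
case/and3P => us bl ub; have [uW _ _] := stem_deg us; have [bW _] := lowP bl.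
by rewrite [e b u]e_sym (low_upper_neq bl (stem_upper us)).
Qed.

Lemma twig_uniq u b b' : twig u b -> b' \in low -> e u b' -> b' = b.
Proof. by case/and3P => us bl ub b'l ub'; apply: (stem_low_uniq us). Qed.

Lemma twig_deg u b : twig u b -> deg u = d.+1 /\ deg b = d.
Proof.
move=> tw; have [us bl _ _ _] := twigP tw; have [_ ->] := lowP bl; split=> //.
have [_ degu degl] := stem_deg us.
have : deg_in low u <= 1.
  rewrite leqNgt; apply/negP => /card_gt1P [x [y []]].
  rewrite !in_setI ![_ \in N u]inE => /andP [ux xl] /andP [uy yl].
  by rewrite (twig_uniq tw xl ux) (twig_uniq tw yl uy) eqxx.
by have := deg_split u; move: us; rewrite inE => /andP []; arith.
Qed.

Lemma card_twig u b : twig u b -> #|core_nbh [:: b; u]| <= 2 * d + 1.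
Proof.
move=> tw; have [_ _ [ub _] [uW bW] _] := twigP tw; have [du db] := twig_deg tw.
have := card_core_nbh_adj (s := [:: u]) uW bW (mem_head _ _) ub.
by rewrite card_core_nbh1 // du db; arith.
Qed.

Lemma twig_touching u b x : twig u b -> x \in core_nbh [:: b; u] ->
  #|N x :\: W| = 0.
Proof.
move=> tw; have [_ _ _ [uW bW] neq] := twigP tw.
move=> /(touching0 (touching_pair0 neq bW uW (card_twig tw))) ->.
exact: cards0.
Qed.

Lemma twig_no_common u b x : twig u b -> x \in W -> e u x -> e b x = false.
Proof.
move=> tw xW ux; apply/negP => bx.
have [_ _ [ub bu] [uW bW] neq] := twigP tw; have [du db] := twig_deg tw.
have xu : x != u by apply: contraTneq ux => ->; rewrite e_irr.
have := @card_core_nbh_cons [set u; b; x] b [:: u] bW.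
have hb : [set u; b; x] \subset core_nbh [:: b].
  rewrite !subUset !sub1set (mem_core_nbh1 uW bu) (mem_core_nbh1 xW bx).
  by rewrite (mem_core_nbh_self bW (mem_head _ _)).
have hu : [set u; b; x] \subset core_nbh [:: u].
  rewrite !subUset !sub1set (mem_core_nbh1 bW ub) (mem_core_nbh1 xW ux).
  by rewrite (mem_core_nbh_self uW (mem_head _ _)).
have -> : #|[set u; b; x]| = 3.
  have xb : x != b by apply: contraTneq bx => ->; rewrite e_irr.
  by rewrite setUC cardsU1 cards2 !inE negb_or xu xb [u == b]eq_sym neq.
move=> /(_ hb hu); rewrite card_core_nbh1 // du db => leC.
by have := core_nbh_large (extendable_pair neq bW uW) isT; rewrite /=; arith.
Qed.


Lemma twig_peeled u b : twig u b -> #|N u :\: W| = 0 /\ #|N b :\: W| = 0.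
Proof.
move=> tw; have [_ _ _ [uW bW] _] := twigP tw.
by split; apply: (twig_touching tw); apply: mem_core_nbh_self; rewrite ?inE ?eqxx ?orbT.
Qed.

Lemma extendable_twigs u b u' b' : twig u b -> twig u' b' -> b != b' ->
  extendable [:: b; b'; u; u'].
Proof.
move=> tw tw' neq; have [us bl [ub bu] [uW bW] nbu] := twigP tw.
have [us' bl' [ub' bu'] [uW' bW'] nbu'] := twigP tw'.
have [[pu pb] [pu' pb']] := (twig_peeled tw, twig_peeled tw').
have ub'F : e u b' = false.
  by apply: contraNF neq => /(twig_uniq tw bl') ->.
have u'bF : e u' b = false.
  by apply: contraNF neq => /(twig_uniq tw' bl) ->.
have nuu' : u != u' by apply: contraFneq ub'F => ->.
have nbu2 := low_upper_neq bl (stem_upper us').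
have nbu2' := low_upper_neq bl' (stem_upper us).
rewrite /extendable /= !inE !negb_or neq nbu nbu2 nbu' nbu2' nuu' uW bW uW' bW' /=.
rewrite !e_irr !(low_indep bl bl', low_indep bl' bl) bu bu' ub ub'.
rewrite ub'F u'bF [e b' u]e_sym ub'F [e b u']e_sym u'bF.
(* Adjacent or not, [u] and [u'] have degree at most 2 in the set. *)
by rewrite pu pb pu' pb' [e u' u]e_sym; case: (e u u').
Qed.

(** Otherwise the path b, u, u', b' has three edges and reaches at most 4d vertices. *)
Lemma twig_indep u b u' b' : twig u b -> twig u' b' -> e u u' = false.
Proof.
move=> tw tw'; apply/negP => uu'.
have [us bl [ub bu] [uW bW] nbu] := twigP tw.
have [us' bl' [ub' bu'] [uW' bW'] nbu'] := twigP tw'.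
have [[du db] [du' db']] := (twig_deg tw, twig_deg tw').
have neq : b != b'.
  apply/negP => /eqP bb'; rewrite -bb' in bu'.
  by rewrite (twig_no_common tw uW' uu') in bu'.
have c1 := card_core_nbh1 uW'.
have u'u : e u' u by rewrite e_sym.
have c2 := card_core_nbh_adj (s := [:: u']) uW' uW (mem_head _ _) u'u.
have m3 : u' \in [:: u; u'] by rewrite !inE eqxx orbT.
have c3 := card_core_nbh_adj (s := [:: u; u']) uW' bW' m3 ub'.
have m4 : u \in [:: b'; u; u'] by rewrite !inE eqxx orbT.
have c4 := card_core_nbh_adj (s := [:: b'; u; u']) uW bW m4 ub.
by have := core_nbh_large (extendable_twigs tw tw' neq) isT; rewrite /=; arith.
Qed.

Lemma twig_inj u u' b : twig u b -> twig u' b -> u = u'.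
Proof.
move=> tw tw'; apply/eqP; apply: contraT => neq.
have [us bl [ub bu] [uW bW] nbu] := twigP tw.
have [us' _ [u'b bu'] [uW' _] nbu'] := twigP tw'.
have [[du db] [du' _]] := (twig_deg tw, twig_deg tw').
have [[pu pb] [pu' _]] := (twig_peeled tw, twig_peeled tw').
have ext : extendable [:: u; u'; b].
  rewrite /extendable /= !inE !negb_or neq [u == b]eq_sym nbu [u' == b]eq_sym nbu'.
  rewrite uW uW' bW.
  by rewrite !e_irr ub bu u'b bu' (twig_indep tw tw') (twig_indep tw' tw) pu pb pu'.
have c1 := card_core_nbh1 bW.
have c2 := card_core_nbh_adj (s := [:: b]) bW uW' (mem_head _ _) bu'.
have m3 : b \in [:: u'; b] by rewrite !inE eqxx orbT.
have c3 := card_core_nbh_adj (s := [:: u'; b]) bW uW m3 bu.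
by have := core_nbh_large ext isT; rewrite /=; arith.
Qed.

(** Two twig edges and one common neighbour leave at most 4d + 1 vertices. *)
Lemma twig_disjoint u b u' b' x : twig u b -> twig u' b' ->
  x \in W -> e u x -> e u' x -> u = u'.
Proof.
move=> tw tw' xW ux u'x; apply/eqP; apply: contraT => neq.
have [us bl [ub bu] [uW bW] nbu] := twigP tw.
have [us' bl' [ub' bu'] [uW' bW'] nbu'] := twigP tw'.
have [[du db] [du' db']] := (twig_deg tw, twig_deg tw').
have nbb' : b != b'.
  by apply/negP => /eqP bb'; rewrite -bb' in tw'; rewrite (twig_inj tw tw') eqxx in neq.
have c1 := card_core_nbh1 uW'.
have c2 := card_core_nbh_share (s := [:: u']) uW
  (mem_core_nbh1 xW ux) (mem_core_nbh1 xW u'x).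
have m3 : u' \in [:: u; u'] by rewrite !inE eqxx orbT.
have c3 := card_core_nbh_adj (s := [:: u; u']) uW' bW' m3 ub'.
have m4 : u \in [:: b'; u; u'] by rewrite !inE eqxx orbT.
have c4 := card_core_nbh_adj (s := [:: b'; u; u']) uW bW m4 ub.
by have := core_nbh_large (extendable_twigs tw tw' nbb') isT; rewrite /=; arith.
Qed.

Lemma twig_low_disjoint u b b' x : twig u b -> b' \in low -> b' != b ->
  x \in W -> e u x -> e b' x = false.
Proof.
move=> tw bl' neq xW ux; apply/negP => b'x.
have [us bl [ub bu] [uW bW] nbu] := twigP tw; have [du db] := twig_deg tw.
have [pu pb] := twig_peeled tw; have [bW' db'] := lowP bl'.
have ub'F : e u b' = false.
  by apply: contraNF neq => /(twig_uniq tw bl') ->.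
have ext : extendable [:: b'; b; u].
  rewrite /extendable /= !inE !negb_or neq nbu (low_upper_neq bl' (stem_upper us)).
  rewrite uW bW bW' !e_irr !(low_indep bl bl', low_indep bl' bl).
  rewrite [e b' u]e_sym ub'F ub bu pu pb.
  by rewrite /= !add0n peeled_le2.
have c1 := card_core_nbh1 uW.
have c2 := card_core_nbh_adj (s := [:: u]) uW bW (mem_head _ _) ub.
have xbu : x \in core_nbh [:: b; u].
  by apply: mem_core_nbh ux; rewrite ?inE ?eqxx ?orbT.
have c3 := card_core_nbh_share (s := [:: b; u]) bW' (mem_core_nbh1 xW b'x) xbu.
by have := core_nbh_large ext isT; rewrite /=; arith.
Qed.

(** A failing [x] has exactly one stem neighbour [u] and, twigs being far apart, no low neighbour,
    so its degree in [W] is d + 1. The path x, u, b then reaches only 3d + 1 vertices. *)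
Lemma min_deg_upperD x : x \in upper :\: stem -> d < deg_in (upper :\: stem) x.
Proof.
rewrite inE => /andP [xs xu]; rewrite ltnNge; apply/negP => degx.
have [xW _] := upperP xu.
have sub : stem \subset upper by apply/subsetP => u; apply: stem_upper.
have split := deg_inD x sub.
have degU : d < deg_in upper x by move: xs; rewrite inE xu /= -ltnNge.
have /card_gt0P [u] : 0 < deg_in stem x by arith.
rewrite inE [u \in N x]inE => /andP [xu' us]; have [b tw] := stem_twig us.
have [_ bl [ub bu] [uW bW] nbu] := twigP tw; have [du db] := twig_deg tw.
have [pu pb] := twig_peeled tw.
have ux : e u x by rewrite e_sym.
have deg1 : deg_in stem x <= 1.
  rewrite leqNgt; apply/negP => /card_gt1P [v [w []]].
  rewrite !in_setI ![_ \in N x]inE ![e x _]e_sym => /andP [vx /stem_twig [bv tv]].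
  by move=> /andP [wx /stem_twig [bw tw']]; rewrite (twig_disjoint tv tw' xW vx wx) eqxx.
have xlow b' : b' \in low -> e b' x = false.
  case: (eqVneq b' b) => [->|neq] bl'; first exact: twig_no_common tw xW ux.
  exact: twig_low_disjoint tw bl' neq xW ux.
have deg0 : deg_in low x = 0.
  apply/eqP; rewrite cards_eq0; apply/eqP/setP => b'; rewrite in_setI in_set0 inE e_sym.
  by apply/negP => /andP [b'x /xlow]; rewrite b'x.
have degW := deg_split x.
have xbu : x \in core_nbh [:: b; u].
  by apply: mem_core_nbh ux; rewrite ?inE ?eqxx ?orbT.
have px := twig_touching tw xbu.
have nxu : x != u by apply: contraNneq xs => ->.
have ext : extendable [:: x; b; u].
  rewrite /extendable /= !inE !negb_or nbu eq_sym (low_upper_neq bl xu) nxu.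
  by rewrite uW bW xW !e_irr [e x b]e_sym xlow // xu' ux ub bu pu pb px.
have c1 := card_core_nbh1 uW.
have c2 := card_core_nbh_adj (s := [:: u]) uW bW (mem_head _ _) ub.
have m3 : u \in [:: b; u] by rewrite !inE eqxx orbT.
have c3 := card_core_nbh_adj (s := [:: b; u]) uW xW m3 ux.
by have := core_nbh_large ext isT; rewrite /=; arith.
Qed.

(** * The stem is empty, and one round of peeling *)

Lemma budget_pair (u v : T) : u != v -> u \in W -> v \in W ->
  (forall x, x \in core_nbh [:: u; v] -> x \notin [:: u; v] -> d < zeta e x) ->
  2 * d + 1 < #|core_nbh [:: u; v]|.
Proof.
move=> neq uW vW zC; rewrite ltnNge; apply/negP => leC.
have [us sW sdeg] := extendableP (extendable_pair neq uW vW).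
have leC' : #|core_nbh [:: u; v]| <= size [:: u; v] + (2 * d - 1) by rewrite /=; arith.
have := core_nbh_budget (s := [:: u; v]) isT us sW sdeg zC leC'; rewrite /= => H.
have : 4 * 2 * (3 * d + 1) * (3 * d + 4) <
   12 * (2 * (3 * d + 4) + (2 * d - 1) * (3 * d + 1)).
  by apply: leq_ltn_trans H; rewrite !leq_mul2r leq_addr !orbT.
(* Expanded, the inequality says 60d < 52. *)
by case: (d) d_gt0 => // k _; nia.
Qed.

(** The other vertices near a twig lie in [upper :\: stem], hence have [zeta] above [d]; the twig
    then reaches too few vertices for the sharper count. *)
Lemma stem0 : stem = set0.
Proof.
apply/eqP; apply: contraT => /set0Pn [u us]; have [b tw] := stem_twig us.
have [_ bl [ub bu] [uW bW] nbu] := twigP tw.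
suff : 2 * d + 1 < #|core_nbh [:: b; u]| by rewrite ltnNge card_twig.
apply: budget_pair => // x xC; rewrite !inE negb_or => /andP [xb xu].
apply: (le_zeta min_deg_upperD); move: xC; rewrite !inE /= orbF.
case/andP => xW; rewrite xW ![_ == x]eq_sym (negbTE xb) (negbTE xu) /= => xN.
have xl : x \notin low.
  apply/negP => xl; move: xN; rewrite low_indep //= => /(twig_uniq tw xl) xbE.
  by rewrite xbE eqxx in xb.
have xs : x \notin stem.
  apply/negP => xs; have [b' tw'] := stem_twig xs; have [_ _ [xb' _] _ _] := twigP tw'.
  move: xN; rewrite (twig_indep tw tw') orbF [e b x]e_sym => /(twig_uniq tw' bl) bE.
  by rewrite -bE in tw'; rewrite (twig_inj tw' tw) eqxx in xu.
by move: xs xl; rewrite !inE xW /= => -> ->.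
Qed.

Lemma min_deg_upper x : x \in upper -> d < deg_in upper x.
Proof. by have := @min_deg_upperD x; rewrite stem0 setD0. Qed.

Lemma near_low_zeta s x : {subset s <= low} -> x \in core_nbh s -> x \notin s ->
  d < zeta e x.
Proof.
move=> sl; rewrite inE => /andP [xW /hasP [b bs /orP [/eqP <-|bx]]]; first by rewrite bs.
move=> _; apply: (le_zeta min_deg_upper); rewrite inE xW andbT.
by apply: contraTN bx => xl; rewrite low_indep // sl.
Qed.

(** This keeps the vertices about to be peeled away from those already peeled, as [layered_upper]
    requires. *)
Lemma low_touching b : b \in low -> touching [:: b] = set0.
Proof.
move=> bl; have [bW db] := lowP bl.
apply/eqP; rewrite -cards_eq0 -leqn0 leqNgt; apply/negP => t0.
have sl : {subset [:: b] <= low} by move=> x; rewrite inE => /eqP -> //.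
have sW : {subset [:: b] <= W} by move=> x /sl /lowP [].
have sdeg x : x \in [:: b] -> count (e x) [:: b] + #|N x :\: W| <= 2.
  by rewrite inE => /eqP ->; rewrite /= e_irr !add0n peeled_le2.
have leC : #|core_nbh [:: b]| <= size [:: b] + d by rewrite card_core_nbh1 // db.
have := core_nbh_budget (s := [:: b]) isT isT sW sdeg (fun x => near_low_zeta sl) leC.
rewrite /= => H; have : (4 * 1 + 1) * (3 * d + 1) * (3 * d + 4) <
   12 * (1 * (3 * d + 4) + d * (3 * d + 1)).
  by apply: leq_ltn_trans H; rewrite !leq_mul2r leq_add2l t0 !orbT.
(* Expanded, the inequality says 9d^2 + 27d < 28. *)
by move: d_gt0; nia.
Qed.

Lemma low_disjoint b b' x : b \in low -> b' \in low ->
  x \in W -> e b x -> e b' x -> b = b'.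
Proof.
move=> bl b'l xW bx b'x; apply/eqP; apply: contraT => neq.
have [[bW db] [b'W db']] := (lowP bl, lowP b'l).
have sl : {subset [:: b; b'] <= low} by apply/allP; rewrite /= bl b'l.
have := budget_pair neq bW b'W (fun y => near_low_zeta sl).
have := card_core_nbh_share (s := [:: b']) bW
  (mem_core_nbh1 xW bx) (mem_core_nbh1 xW b'x).
by rewrite card_core_nbh1 // db db'; arith.
Qed.

Lemma low_nbh b : b \in low -> N b \subset W.
Proof.
move=> bl; have [bW _] := lowP bl; rewrite -setD_eq0.
by rewrite (touching0 (low_touching bl)) // mem_core_nbh_self ?mem_head.
Qed.

Lemma low_peeled b y x : b \in low -> y \notin W -> x \in core_nbh [:: b] ->
  e y x = false.
Proof.
move=> bl yW xC; apply/negP => yx.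
suff : y \in touching [:: b] by rewrite low_touching // inE.
by rewrite inE yW; apply/set0Pn; exists x; rewrite inE xC inE yx.
Qed.

Lemma layered_upper : layered upper d.+1.
Proof.
have notU y : y \notin upper -> (y \notin W) || (y \in low).
  by rewrite !inE negb_and negbK; case: (y \in W) => //=; rewrite orbF.
split=> [|y|y|y|v vU].
- exact: min_deg_upper.
- move=> /notU /orP [yW|yl]; apply/subsetP => x xy; rewrite inE.
    rewrite (subsetP (nbh_peeled LW yW)) // andbT; apply: contraTN xy => xl.
    have [xW _] := lowP xl.
    by rewrite inE (low_peeled xl) // mem_core_nbh_self ?mem_head.
  rewrite (subsetP (low_nbh yl)) // andbT; apply: contraTN xy => xl.
  by rewrite inE low_indep.
- move=> /notU /orP [yW|yl]; first exact/leqW/(deg_peeled LW).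
  by have [_ <-] := lowP yl; rewrite /deg_in (setIidPl (low_nbh yl)).
- move=> /notU /orP [yW|yl]; first exact: zeta_peeled LW _ yW.
  have [yW dy] := lowP yl; have := core_zeta yW.
  by rewrite -dy /deg_in (setIidPl (low_nbh yl)).
have [vW _] := upperP vU; rewrite leqNgt; apply/negP => /card_gt1P [x [y []]].
rewrite 2!in_setD ![_ \in N v]inE => /andP [/notU xU vx] /andP [/notU yU vy].
have mixed z w : z \notin W -> w \in low -> e v z -> e v w -> False.
  move=> zW wl vz vw.
  have vC : v \in core_nbh [:: w] by apply: mem_core_nbh1; rewrite // e_sym.
  by have := low_peeled wl zW vC; rewrite e_sym vz.
case/orP: xU => [xW|xl]; case/orP: yU => [yW|yl] neq.
- have : 1 < #|N v :\: W|.
    by apply/card_gt1P; exists x, y; rewrite !inE xW yW vx vy.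
  by rewrite ltnNge (uniq_peeled LW vW).
- exact: mixed xW yl vx vy.
- exact: mixed yW xl vy vx.
by rewrite (@low_disjoint x y v) ?eqxx // in neq; rewrite e_sym.
Qed.

End Step.

(** * Peeled vertices become cheap *)

(** The 4 is forced by k = 1, where 3/4 + 3/(3m + 1) is at most 1 only from m = 4 on. For k at least
    3, m = k + 1 suffices. *)
Lemma peeled_cost_le1 k : 0 < k ->
  (wt_of k + k%:R * wt_of (maxn 4 k.+1) <= 1)%R.
Proof.
move=> k_gt0; have [k3|k2] := leqP 3 k; last first.
  have -> : maxn 4 k.+1 = 4 by lia.
  have w4 : wt_of 4 = (3 / 13)%R by exact: wt_ofE.
  have [->|->] : k = 1 \/ k = 2 by lia.
    by rewrite w4 [wt_of 1](_ : _ = 3 / 4)%R; [lra | exact: wt_ofE].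
  by rewrite w4 [wt_of 2](_ : _ = 3 / 7)%R; [lra | exact: wt_ofE].
have -> : maxn 4 k.+1 = k.+1 by lia.
have x3 : (3 <= k%:R :> rat)%R by rewrite (ler_nat _ 3 k).
rewrite !wt_ofE.
have wE n : ((3 * n + 1)%:R = 3 * n%:R + 1 :> rat)%R by rewrite natrD natrM.
rewrite !wE -[k.+1]addn1 natrD.
move: (k%:R)%R x3 => x x3.
rewrite -subr_ge0 (_ : _ - _ = (3 * x - 8) / ((3 * x + 1) * (3 * (x + 1) + 1)))%R.
  by apply: divr_ge0; [lra | apply: mulr_ge0; lra].
by field; lra.
Qed.

(** Below d = 4 peeled vertices have degree at most 2, so another round of peeling applies and [d]
    grows; from d = 4 on, a peeled vertex would be cheap alone. *)
Lemma layered_setT W d :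
  (forall v, 0 < #|N v|) -> costly -> 0 < d -> layered W d -> W = setT.
Proof.
move=> no_iso costs; have [n] := ubnP (4 - d); elim: n W d => // n IH W d nd d_gt0 LW.
case: (ltnP d 4) => d4.
  have deg2 y : y \notin W -> #|N y| <= 2 by move/(deg_peeled LW); lia.
  have UT : upper W d = setT.
    by apply: (IH _ d.+1); [lia | | exact: layered_upper].
  apply/eqP; rewrite eqEsubset subsetT -UT; exact: subsetDl.
apply/setP => y; rewrite inE; apply: contraT => yW.
have y0 : [set y] != set0 by apply/set0Pn; exists y; rewrite inE.
have degy : max_degree_induced e [set y] <= 2.
  apply/bigop.bigmax_leqP => x _; apply: leq_trans (subset_leq_card (subsetIr _ _)) _.
  by rewrite cards1.
have := costs _ y0 degy; rewrite cards1 => lt1.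
have le1 : (\sum_(v in closed_nbh e [set y]) wt v <=
    wt_of #|N y| + #|N y|%:R * wt_of (maxn 4 #|N y|.+1))%R.
  rewrite /closed_nbh big_set1; apply: le_trans (sum_setU_le _ _ wt_ge0) _.
  rewrite big_set1; apply: lerD; first exact/wt_le/(zeta_peeled LW).
  apply: sum_const_le => v vy; apply: wt_le.
  apply: leq_trans (le_zeta (min_deg_core LW) (subsetP (nbh_peeled LW yW) _ vy)).
  by rewrite geq_max d4 (deg_peeled LW).
by have := lt_le_trans lt1 (le_trans le1 (peeled_cost_le1 (no_iso y))); rewrite ltxx.
Qed.

End CheapSets.

Theorem theorem6 (T : finType) (e : rel T)
    (e_sym : symmetric e) (e_irr : irreflexive e) (T_gt0 : 0 < #|T|) :
  exists S : {set T}, S != set0 /\ cheap e 2 S.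
Proof.
have [v0 _] := card_gt0P T_gt0.
have [/existsP [v isov]|] := boolP [exists v, isolated e v].
  exists [set v]; split; first by apply/set0Pn; exists v; rewrite inE.
  by left=> u; rewrite inE => /eqP ->.
rewrite negb_exists => /forallP no_iso.
have [/existsP [S /and3P [S0 degS sumS]]|] := boolP [exists S : {set T},
  [&& S != set0, max_degree_induced e S <= 2 &
    (\sum_(v in closed_nbh e S) ((zeta e v)%:R + 3%:R^-1)^-1 <= #|S|%:R :> rat)%R]].
  by exists S; split=> //; right; split.
rewrite negb_exists => /forallP no_cheap; exfalso.
have costs : costly e.
  move=> S S0 degS; rewrite ltNge; apply/negP => sumS.
  by have := no_cheap S; rewrite S0 degS sumS.
have deg_gt0 v : 0 < #|nbh e v| by rewrite card_gt0; apply: no_iso.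
have [v _ minv] := arg_minnP (fun v => #|nbh e v|) (isT : predT v0).
have LT : layered e setT #|nbh e v|.
  split=> [u _|y|y|y|u _]; rewrite ?inE ?setDT ?cards0 //.
  by rewrite deg_inT minv.
have notT y : y \notin [set: T] -> #|nbh e y| <= 2 by rewrite inE.
(* With nothing peeled yet, the degree condition on peeled vertices is vacuous, so this first round
   works for any minimum degree. It removes [v]. *)
have LU := layered_upper e_sym e_irr deg_gt0 costs (deg_gt0 v) LT notT.
have /setP /(_ v) := layered_setT e_sym e_irr deg_gt0 costs (ltn0Sn _) LU.
by rewrite !inE deg_inT eqxx.
Qed.
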